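(* Let $\mathcal G=\langle n;E\rangle$ be a simple connected graph with vertex set $n=\{0,1,\ldots,n-1\}$ and edge set $E$. Suppose $n$ is the disjoint union of $V_0$ and $V_1$, let $C\subseteq E$ be the set of edges having one endpoint in $V_0$ and the other in $V_1$, and let $\mathcal G_0=\langle V_0;E_0\rangle$ and $\mathcal G_1=\langle V_1;E_1\rangle$ be the subgraphs with $E_i$ the set of edges of $\mathcal G$ with both endpoints in $V_i$ (so $E=E_0\cup C\cup E_1$). Suppose $\mathcal G_0$ is a forest, $2|C|<|V_0|$, and $|V_1|\ge 2$. Then $\mathcal G$ is not perm-complete.
   Context: Permutations in $\mathrm{Sym}(n)$ compose left to right. For a finite sequence $\mathbf s$ in $\mathrm{Sym}(n)$, $\bigcirc\mathbf s$ is the composite of its terms in order, $\mathrm{Seq}(\mathbf s)$ the set of its rearrangements and $\mathrm{Prod}(\mathbf s)=\{\bigcirc\mathbf r:\mathbf r\in\mathrm{Seq}(\mathbf s)\}$; $\mathbf s$ is perm-complete iff $\mathrm{Prod}(\mathbf s)$ is $\mathrm{Alt}(n)$ or $\mathrm{Sym}(n)\setminus\mathrm{Alt}(n)$. A simple graph on vertex set $n$ is perm-complete iff the sequence listing each of its edges $(x\,y)$ exactly once as the transposition $(x\,y)\in\mathrm{Sym}(n)$ is perm-complete (equivalently, it is isomorphic to such a graph; the order of listing is irrelevant). *)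

(* Defs.v *)
From mathcomp Require Import all_boot all_fingroup all_solvable.
Set Implicit Arguments.
Unset Strict Implicit.
Unset Printing Implicit Defensive.

Local Open Scope group_scope.

(* In MathComp (s * t) x = t (s x), so \prod composes left to right. *)
Definition composite (n : nat) (s : seq 'S_n) : 'S_n := \prod_(t <- s) t.

Definition Prod (n : nat) (s : seq 'S_n) : {set 'S_n} :=
  [set p in [seq composite r | r <- permutations s]].

Definition perm_complete (n : nat) (s : seq 'S_n) : Prop :=
  Prod s = 'Alt_('I_n) \/ Prod s = 'Sym_('I_n) :\: 'Alt_('I_n).

(* Edges are the two-element sets {x, y}. *)
Definition simple_edges (T : finType) (E : {set {set T}}) : Prop :=
  forall e : {set T}, e \in E -> #|e| = 2.

Definition adj (T : finType) (E : {set {set T}}) : rel T :=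
  fun x y => [set x; y] \in E.

Definition connected_graph (T : finType) (E : {set {set T}}) : Prop :=
  forall x y : T, connect (adj E) x y.

(* A cycle of a simple graph has at least three vertices; MathComp's ucycle
   also accepts the back-and-forth walk [:: x; y] along a single edge. *)
Definition is_forest (T : finType) (E : {set {set T}}) : Prop :=
  forall c : seq T, ucycle (adj E) c -> size c < 3.

Definition edges_within (T : finType) (E : {set {set T}}) (V : {set T}) :
    {set {set T}} :=
  [set e in E | e \subset V].

Definition edges_between (T : finType) (E : {set {set T}}) (V W : {set T}) :
    {set {set T}} :=
  [set e in E | [exists x in V, exists y in W, e == [set x; y]]].

(* Each edge {x, y} is listed once, through its ordered pair with x < y. *)
Definition edge_transpositions (n : nat) (E : {set {set 'I_n}}) : seq 'S_n :=
  [seq tperm p.1 p.2 |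
     p <- enum [set p : 'I_n * 'I_n | (p.1 < p.2) && adj E p.1 p.2]].

Definition graph_perm_complete (n : nat) (E : {set {set 'I_n}}) : Prop :=
  perm_complete (edge_transpositions E).

(* Main.v *)
Require Import Defs.
From mathcomp Require Import all_boot all_fingroup all_solvable.

Set Implicit Arguments.
Unset Strict Implicit.
Unset Printing Implicit Defensive.

(** Read a product of the edge transpositions as moving a token from each
    vertex: each edge, at its turn, swaps the two tokens at its ends.  A token
    starting in [V0] moves along a trail, since no edge is used twice, and it
    does move, because the graph is connected.  If it never leaves [V0], its
    trail lies in a forest, so it does not end where it began.  Hence if the
    product fixes [V0] pointwise, every token of [V0] crosses [C]; sending it to
    the first edge that it crosses is injective, so [#|V0| <= #|C|].  But since
    [#|V1| >= 2] there are permutations of both parities fixing [V0]. *)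

Section Tokens.
Local Open Scope group_scope.
Variable T : finType.
Implicit Types (p : T * T) (ps : seq (T * T)) (V : {set T}) (E : {set {set T}}).

Definition edge_of p : {set T} := [set p.1; p.2].

Definition tprod ps : {perm T} := \prod_(p <- ps) tperm p.1 p.2.

Lemma tprod_cons p ps x : tprod (p :: ps) x = tprod ps (tperm p.1 p.2 x).
Proof. by rewrite /tprod big_cons permM. Qed.

Lemma edge_of_moved p x :
  tperm p.1 p.2 x != x -> edge_of p = [set x; tperm p.1 p.2 x].
Proof.
by rewrite /edge_of; case: tpermP => [->|->|_ _] //; rewrite ?eqxx // setUC.
Qed.

(** Meaningful only for [x] in [V]: the test looks only at where the token lands, so a token
    starting outside [V] may be assigned an edge that does not touch it. *)
Fixpoint exit_edge V ps x : option {set T} :=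
  if ps is p :: ps' then
    let y := tperm p.1 p.2 x in
    if y \in V then exit_edge V ps' y else Some (edge_of p)
  else None.

Lemma exit_edge_mem V ps x e : exit_edge V ps x = Some e -> e \in map edge_of ps.
Proof.
elim: ps x => //= p ps IH x; case: ifP => _; last by case=> <-; rewrite mem_head.
by move/IH=> eps; rewrite inE eps orbT.
Qed.

Lemma exit_edge_between V ps x e : x \in V -> exit_edge V ps x = Some e ->
  exists2 a, a \in V & exists2 b, b \notin V & e = [set a; b].
Proof.
elim: ps x => //= p ps IH x xV; case: ifP => [yV|/negbT yV]; first exact: IH.
case=> <-; exists x => //; exists (tperm p.1 p.2 x) => //; apply: edge_of_moved.
by apply: contraNneq yV => ->.
Qed.

(** As no edge recurs, both tokens leave [V] at the same moment. The edge then has one end outside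
    [V], so both tokens sit at its other end just before, and permutations are injective. *)
Lemma exit_edge_inj V ps x y e : uniq (map edge_of ps) ->
  x \in V -> y \in V ->
  exit_edge V ps x = Some e -> exit_edge V ps y = Some e -> x = y.
Proof.
elim: ps x y => //= p ps IH x y /andP[pps ups] xV yV.
case: ifP => [x'V|/negbT x'V]; case: ifP => [y'V|/negbT y'V].
- by move=> ex ey; apply: perm_inj (IH _ _ ups x'V y'V ex ey).
- by move=> /exit_edge_mem eps [pe]; rewrite pe eps in pps.
- by move=> [pe] /exit_edge_mem eps; rewrite pe eps in pps.
have moved z : z \in V -> tperm p.1 p.2 z \notin V -> z = p.1 \/ z = p.2.
  by move=> zV; case: tpermP => [->|->|_ _]; rewrite ?zV //; auto.
move=> _ _; case: (moved x xV x'V) (moved y yV y'V) (x'V) (yV) => -> [] -> //.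
  by rewrite tpermL => /negbTE->.
by rewrite tpermR => /negbTE->.
Qed.

(** Read [U] as the edges still to come and [s] as the way back over used edges. Were [w] on [s],
    the new edge would close a cycle. *)
Lemma forest_path_extend E (U : seq {set T}) v w s :
  is_forest E -> uniq (v :: s) ->
  path (fun a b => adj E a b && ([set a; b] \notin U)) v s ->
  adj E v w -> [set v; w] \in U -> w \notin s.
Proof.
move=> forE us ps vw vwU; apply/negP => ws.
case/splitPr: ws us ps => s1 s2; rewrite -cat_rcons -cat_cons cat_uniq cat_path.
move=> /andP[us _] /andP[ps _].
have cyc : ucycle (adj E) (v :: rcons s1 w).
  rewrite /ucycle us andbT /= rcons_path last_rcons.
  have -> : adj E w v by rewrite /adj setUC.
  by rewrite andbT; apply: sub_path ps => a b /andP[].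
have := forE _ cyc; rewrite /= size_rcons.
(* A closed walk with fewer than three vertices forces [s1] to be empty; the path would then start
   with the edge from [v] to [w], which lies in [U]. *)
case: s1 ps {us cyc} => //=; rewrite vwU /=.
by rewrite andbF.
Qed.

(** Invariant of a token now at [v]: [s] lists the vertices already visited, latest first, joined by
    edges absent from the remaining list [ps]. *)
Lemma forest_token_avoids E V ps v s :
  is_forest (edges_within E V) ->
  {in ps, forall p, edge_of p \in E} -> uniq (map edge_of ps) ->
  v \in V -> uniq (v :: s) ->
  path (fun a b => adj (edges_within E V) a b
                   && ([set a; b] \notin map edge_of ps)) v s ->
  exit_edge V ps v = None -> tprod ps v \notin s.
Proof.
move=> forE; elim: ps v s => [|p ps IH] v s psE ups vV us.
  by rewrite /tprod big_nil perm1 => _ _; case/andP: us.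
case/andP: ups => pps ups; rewrite tprod_cons [exit_edge _ _ _]/=.
have psE' : {in ps, forall q, edge_of q \in E}.
  by move=> q qps; apply: psE; rewrite inE qps orbT.
have weaken a b : adj (edges_within E V) a b &&
    ([set a; b] \notin map edge_of (p :: ps)) ->
    adj (edges_within E V) a b && ([set a; b] \notin map edge_of ps).
  by rewrite /= inE negb_or => /and3P[-> _ ->].
have [->|mv] := eqVneq (tperm p.1 p.2 v) v.
  by rewrite vV => pth; apply: IH => //; apply: sub_path pth.
have eqe := edge_of_moved mv; set w := tperm _ _ v in mv eqe *.
case: ifP => // wV pth.
have vw : adj (edges_within E V) v w.
  by rewrite /adj inE -eqe psE ?mem_head //= eqe subUset !sub1set vV.
have ws : w \notin s.
  by apply: (forest_path_extend forE us pth vw); rewrite -eqe /= mem_head.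
(* The vertex just left joins the trail, so the induction gives avoidance of [v] as well as of
   [s]. *)
move/(IH w (v :: s) psE' ups wV); rewrite inE negb_or => H.
have /andP[] // : (tprod ps w != v) && (tprod ps w \notin s).
apply: H; first by rewrite cons_uniq inE negb_or mv ws.
rewrite /= {1}/adj setUC; move: (vw); rewrite /adj => -> /=.
by rewrite -eqe pps; apply: sub_path pth.
Qed.

(** The token waits at [x] until the first edge that moves it; from then on [[:: x]] is a trail to
    avoid. *)
Lemma forest_token_moves E V ps x :
  is_forest (edges_within E V) ->
  {in ps, forall p, edge_of p \in E} -> uniq (map edge_of ps) ->
  x \in V -> has (fun p => tperm p.1 p.2 x != x) ps ->
  exit_edge V ps x = None -> tprod ps x != x.
Proof.
move=> forE; elim: ps => //= p ps IH psE /andP[pps ups] xV.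
have psE' : {in ps, forall q, edge_of q \in E}.
  by move=> q qps; apply: psE; rewrite inE qps orbT.
rewrite tprod_cons; have [->|mv] /= := eqVneq (tperm p.1 p.2 x) x.
  by rewrite xV; apply: IH.
have eqe := edge_of_moved mv; set w := tperm _ _ x in mv eqe *.
case: ifP => // wV _ ex.
have: tprod ps w \notin [:: x]; last by rewrite inE.
apply: (forest_token_avoids forE psE' ups wV) => //.
  by rewrite /= inE mv.
rewrite /= /adj setUC -eqe pps inE psE ?mem_head //=.
by rewrite eqe subUset !sub1set xV wV.
Qed.

Lemma card_fixed_le_edges_between E V W ps :
  V :|: W = [set: T] -> is_forest (edges_within E V) ->
  {in ps, forall p, edge_of p \in E} -> uniq (map edge_of ps) ->
  {in V, forall x, has (fun p => tperm p.1 p.2 x != x) ps} ->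
  {in V, forall x, tprod ps x = x} ->
  #|V| <= #|edges_between E V W|.
Proof.
move=> VW forE psE ups mvV fixV.
have exitV x : x \in V -> exists e, exit_edge V ps x = Some e.
  move=> xV; case ex: (exit_edge V ps x) => [e|]; first by exists e.
  have := forest_token_moves forE psE ups xV (mvV x xV) ex.
  by rewrite fixV // eqxx.
(* By [exitV], the default [set0] is never taken on [V]. *)
pose f x := odflt set0 (exit_edge V ps x).
have injf : {in V &, injective f}.
  move=> x y xV yV; rewrite /f; have [[e ex] [e' ey]] := (exitV x xV, exitV y yV).
  by rewrite ex ey /= => eqe; apply: exit_edge_inj ups xV yV ex _; rewrite eqe.
rewrite -(card_in_imset injf); apply/subset_leq_card/subsetP => _ /imsetP[x xV ->].
have [e ex] := exitV x xV; rewrite /f ex /= inE.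
have -> : e \in E by have /mapP[p pps ->] := exit_edge_mem ex; apply: psE.
have [a aV [b bV ->]] := exit_edge_between xV ex.
apply/existsP; exists a; rewrite aV /=; apply/existsP; exists b.
by have := in_setT b; rewrite -VW inE (negbTE bV) /= => ->; rewrite eqxx.
Qed.

End Tokens.

(** Lifts a rearrangement of the transpositions to one of the vertex pairs, from which the edges can
    be read off. *)
Lemma perm_eq_map_inv (S T : eqType) (f : S -> T) (s : seq T) (t : seq S) :
  perm_eq s (map f t) -> exists2 t', perm_eq t' t & s = map f t'.
Proof.
elim: s t => [|x s IH] t est.
  by exists [::] => //; case: t est => // y t /perm_size.
have /mapP[y yt def_x] : x \in map f t by rewrite -(perm_mem est) mem_head.
have tE := perm_to_rem yt; move: est.
rewrite (permPr (perm_map f tE)) /= def_x perm_cons => /IH[t' et' ->].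
by exists (y :: t') => //; rewrite perm_sym (permPl tE) perm_cons perm_sym.
Qed.

Lemma connected_has_neighbour (T : finType) (E : {set {set T}}) (x y : T) :
  simple_edges E -> connected_graph E -> x != y ->
  exists2 z, z != x & adj E x z.
Proof.
move=> simE conE neq_xy; have /connectP[[|z s] /=] := conE x y.
  by move=> _ eq_yx; rewrite eq_yx eqxx in neq_xy.
case/andP=> xz _ _; exists z => //; have := simE _ xz; rewrite cards2 eq_sym.
by case: eqP.
Qed.

Lemma edge_of_ltn_inj (n : nat) (p q : 'I_n * 'I_n) :
  p.1 < p.2 -> q.1 < q.2 -> edge_of p = edge_of q -> p = q.
Proof.
case: p q => [a b] [c d]; rewrite /edge_of /= => ab cd /setP eqS.
have := eqS a; have := eqS b; have := eqS c; have := eqS d.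
rewrite !inE !eqxx ?orbT /=.
move=> /orP[]/eqP Ed /orP[]/eqP Ec /esym/orP[]/eqP Eb /esym/orP[]/eqP Ea;
  by move: ab cd; rewrite ?Ea ?Eb ?Ec ?Ed ?ltnn // => /ltnW;
  rewrite leqNgt => /negP.
Qed.

Lemma fixing_not_in_Prod (n : nat) (E : {set {set 'I_n}}) (V0 V1 : {set 'I_n})
    (g : 'S_n) :
  simple_edges E -> connected_graph E -> V0 :|: V1 = [set: 'I_n] ->
  [disjoint V0 & V1] -> is_forest (edges_within E V0) ->
  #|edges_between E V0 V1| < #|V0| -> 0 < #|V1| ->
  {in V0, forall x, g x = x} -> g \notin Prod (edge_transpositions E).
Proof.
move=> simE conE VW dVW forE ltC /card_gt0P[v vV1] fixg.
apply/negP; rewrite inE => /mapP[r]; rewrite mem_permutations => rE def_g.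
have [ps psE def_r] := perm_eq_map_inv rE.
have mem_ps p : (p \in ps) = (p.1 < p.2) && adj E p.1 p.2.
  by rewrite (perm_mem psE) mem_enum inE.
have gE : g = tprod ps by rewrite def_g /composite def_r big_map.
move: ltC; rewrite ltnNge => /negP; apply.
apply: (@card_fixed_le_edges_between _ _ _ _ ps) => //.
- by move=> p; rewrite mem_ps => /andP[].
- rewrite map_inj_in_uniq ?(perm_uniq psE) ?enum_uniq // => p q.
  by rewrite !mem_ps => /andP[p12 _] /andP[q12 _]; apply: edge_of_ltn_inj.
(* The vertex [v] of [V1] differs from [x], so connectedness gives [x] a neighbour, and the edge to
   it moves the token. *)
- move=> x xV0; have neq_xv : x != v.
    by apply: contraTneq xV0 => ->; rewrite (disjointFl dVW vV1).
  have [z neq_zx xz] := connected_has_neighbour simE conE neq_xv.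
  apply/hasP; case: (ltngtP x z) => [lt|lt|/val_inj eq_xz].
  + by exists (x, z); rewrite ?mem_ps ?lt //= tpermL.
  + by exists (z, x); rewrite ?mem_ps ?lt /= ?tpermR // /adj setUC.
  by rewrite eq_xz eqxx in neq_zx.
by rewrite -gE.
Qed.

Theorem theorem2p5 (n : nat) (E : {set {set 'I_n}}) (V0 V1 : {set 'I_n})
  (simpleE : simple_edges E)
  (connE : connected_graph E)
  (coverV : V0 :|: V1 = [set: 'I_n])
  (disjV : [disjoint V0 & V1])
  (forest0 : is_forest (edges_within E V0))
  (smallC : 2 * #|edges_between E V0 V1| < #|V0|)
  (bigV1 : 2 <= #|V1|) :
  ~ graph_perm_complete E.
Proof.
have ltC : #|edges_between E V0 V1| < #|V0|.
  by apply: leq_ltn_trans smallC; rewrite leq_pmull.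
have notin g := @fixing_not_in_Prod n E V0 V1 g simpleE connE coverV disjV
  forest0 ltC (ltnW bigV1).
have /card_gt1P[a [b [aV1 bV1 neq_ab]]] := bigV1.
have notV0 x y : x \in V0 -> y \in V1 -> y != x.
  by move=> xV0; apply: contraTneq => ->; rewrite (disjointFr disjV xV0).
(* The identity is an even permutation fixing [V0] pointwise, and [tperm a b] is an odd one. *)
case=> defP.
  have /negP[] := notin 1%g (fun x _ => perm1 x).
  by rewrite defP group1.
have /negP[] : tperm a b \notin Prod (edge_transpositions E).
  by apply: notin => x xV0; rewrite tpermD ?notV0.
by rewrite defP in_setD Alt_even odd_tperm neq_ab inE.
Qed.
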